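(* Let $(A,\circ)$ be a Novikov algebra, $(V,l_A,r_A)$ a bimodule of $(A,\circ)$ (regarded as an $A$-bimodule Novikov algebra with trivial product on $V$) and $\mathcal A=A\ltimes_{l_{A,\star}^*,-r_A^*}V^*$. Let $\kappa\in\mathbf k$, $\alpha,\beta\in\mathrm{Hom}_{\mathbf k}(V,A)$, and $\mathcal P=\alpha^{\mathcal A}$, $\mathcal Q=\beta^{\mathcal A}$, with $\check{\mathcal P}_-=\check\alpha-\tau(\check\alpha)$ and $\check{\mathcal Q}_+=\check\beta+\tau(\check\beta)$ in $\mathcal A\otimes\mathcal A$. Suppose that $\beta$ is a balanced $A$-bimodule homomorphism from $(V,l_A,r_A)$ to $(A,L_A,R_A)$. Then the following conclusions hold. (i)(a) $\alpha$ is an extended $\mathcal O$-operator of weight $0$ with extension $\beta$ of mass $(\kappa,0)$ on $(A,\circ)$ associated to $(V,l_A,r_A)$ if and only if $\check{\mathcal P}_-\pm\check{\mathcal Q}_+$ is a solution of the extended Novikov Yang-Baxter equation of mass $\frac{\kappa+1}{4}$ in $A\ltimes_{l_{A,\star}^*,-r_A^*}V^*$. (i)(b) $\alpha$ is an $\mathcal O$-operator of weight $0$ on $(A,\circ)$ associated to $(V,l_A,r_A)$ if and only if $\check{\mathcal P}_-$ is a skew-symmetric solution of the Novikov Yang-Baxter equation in $A\ltimes_{l_{A,\star}^*,-r_A^*}V^*$. In particular, a linear endomorphism $T:A\to A$ is a Rota-Baxter operator of weight zero if and only if $\check{\mathcal T}_-=\check T-\tau(\check T)$ is a skew-symmetric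 solution of the Novikov Yang-Baxter equation in $A\ltimes_{L_{A,\star}^*,-R_A^*}A^*$. (i)(c) $\alpha$ is an extended $\mathcal O$-operator of weight $0$ with extension $\beta$ of mass $(-1,0)$ on $(A,\circ)$ associated to $(V,l_A,r_A)$ if and only if $\check{\mathcal P}_-\pm\check{\mathcal Q}_+$ is a solution of the Novikov Yang-Baxter equation in $A\ltimes_{l_{A,\star}^*,-r_A^*}V^*$. (ii) Let $(V,l_A,r_A)=(A,L_A,R_A)$ and $\beta=\mathrm{id}$, and write $\check{\mathrm{id}}_+=\check{\mathrm{id}}+\tau(\check{\mathrm{id}})$. Then: (ii)(a) $\alpha$ satisfies $\alpha(x)\circ\alpha(y)-\alpha(\alpha(x)\circ y+x\circ\alpha(y))=-x\circ y$ for all $x,y\in A$ if and only if $\check{\mathcal P}_-\pm\check{\mathrm{id}}_+$ is a solution of the Novikov Yang-Baxter equation in $A\ltimes_{L_{A,\star}^*,-R_A^*}A^*$. (ii)(b) Let $T:A\to A$ be a linear map and $\mathcal T=T^{\mathcal A}$. Then $T$ is a Rota-Baxter operator of weight $\lambda\neq0$ if and only if both $\frac2\lambda(\check{\mathcal T}-\tau(\check{\mathcal T}))+2\,\check{\mathrm{id}}$ and $\frac2\lambda(\check{\mathcal T}-\tau(\check{\mathcal T}))-2\,\check{\mathrm{id}}$ are solutions of the Novikov Yang-Baxter equation in $A\ltimes_{L_{A,\star}^*,-R_A^*}A^*$.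
   Context: $\mathbf k$ is a field of characteristic zero; all vector spaces are finite-dimensional over $\mathbf k$. A Novikov algebra $(A,\circ)$ is a vector space with a bilinear operation satisfying $(a\circ b)\circ c-a\circ(b\circ c)=(b\circ a)\circ c-b\circ(a\circ c)$ and $(a\circ b)\circ c=(a\circ c)\circ b$ for all $a,b,c\in A$. Put $a\star b=a\circ b+b\circ a$, $L_A(a)b=a\circ b$, $R_A(a)b=b\circ a$, $L_{A,\star}=L_A+R_A$. A bimodule of $(A,\circ)$ is $(V,l_A,r_A)$ with $l_A,r_A:A\to\mathrm{End}_{\mathbf k}(V)$ linear and, for all $a,b\in A,v\in V$: $l_A(a\circ b-b\circ a)v=l_A(a)l_A(b)v-l_A(b)l_A(a)v$; $l_A(a)r_A(b)v-r_A(b)l_A(a)v=r_A(a\circ b)v-r_A(b)r_A(a)v$; $l_A(a\circ b)v=r_A(b)l_A(a)v$; $r_A(a)r_A(b)v=r_A(b)r_A(a)v$. For linear $\varphi:A\to\mathrm{End}_{\mathbf k}(V)$, $\varphi^*:A\to\mathrm{End}_{\mathbf k}(V^* )$ is defined by $\langle\varphi^*(a)f,v\rangle=-\langle f,\varphi(a)v\rangle$. Put $l_{A,\star}=l_A+r_A$. The semi-direct product $A\ltimes_{l_{A,\star}^*,-r_A^*}V^*$ is the Novikov algebra $A\oplus V^*$ with product $(a+f)\bullet(b+g)=a\circ b+l_{A,\star}^*(a)g-r_A^*(b)f$. For $\gamma\in\mathrm{Hom}_{\mathbf k}(V,A)$, $\check\gamma\in V^*\otimes A\subset\mathcal A\otimes\mathcal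 A$ is the tensor with $\langle\check\gamma,v\otimes a^*\rangle=\langle a^*,\gamma(v)\rangle$ for $v\in V,a^*\in A^*$; $\gamma^{\mathcal A}:\mathcal A^*=A^*\oplus V\to\mathcal A$ is the map $a^*+u\mapsto\gamma(u)$, whose tensor is again $\check\gamma$. $\tau$ is the flip $a\otimes b\mapsto b\otimes a$. For linear $\beta:V\to A$: $\beta$ is balanced if $l_A(\beta(u))v=r_A(\beta(v))u$; an $A$-bimodule homomorphism to $(A,L_A,R_A)$ if $\beta(l_A(x)u)=x\circ\beta(u)$ and $\beta(r_A(x)u)=\beta(u)\circ x$; $A$-invariant of mass $\kappa$ if these two identities hold after multiplication by $\kappa$. A linear map $\alpha:V\to A$ is an extended $\mathcal O$-operator of weight $0$ with extension $\beta$ of mass $(\kappa,0)$ associated to $(V,l_A,r_A)$ if $\beta$ is balanced and $A$-invariant of mass $\kappa$ and $\alpha(u)\circ\alpha(v)-\alpha(l_A(\alpha(u))v+r_A(\alpha(v))u)=\kappa\,\beta(u)\circ\beta(v)$; it is an $\mathcal O$-operator of weight $0$ if $\alpha(u)\circ\alpha(v)=\alpha(l_A(\alpha(u))v+r_A(\alpha(v))u)$. A Rota-Baxter operator of weight $\lambda$ on $(A,\circ)$ is a linear $T:A\to A$ with $T(x)\circ T(y)=T(T(x)\circ y+x\circ T(y)+\lambda\,x\circ y)$. In a Novikov algebra $(B,\circ)$, for $r=\sum_i x_i\otimes y_i$, $r'=\sum_j x'_j\otimes y'_j$ in $B\otimes B$: $r_{13}\circ r'_{23}=\sum x_i\otimes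 x'_j\otimes y_i\circ y'_j$, $r_{12}\star r'_{23}=\sum x_i\otimes y_i\star x'_j\otimes y'_j$, $r_{13}\circ r'_{12}=\sum x_i\circ x'_j\otimes y'_j\otimes y_i$. The extended Novikov Yang-Baxter equation of mass $\epsilon$ in $B$ is $r_{13}\circ r_{23}+r_{12}\star r_{23}+r_{13}\circ r_{12}=\epsilon\,(r_{13}+(\tau r)_{13})\circ(r_{23}+(\tau r)_{23})$; the Novikov Yang-Baxter equation is the case $\epsilon=0$.
   Formalization: In (ii)(b) the second tensor is (2/λ)(Ť−τ(Ť))−2τ(ǐd) instead of (2/λ)(Ť−τ(Ť))−2ǐd; the printed form is false, e.g. for A=k e with e∘e=e and T=−λ id, which is Rota-Baxter of weight λ. *)

(* Defs.v *)
From HB Require Import structures.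
From mathcomp Require Import all_boot all_algebra ring.
Set Implicit Arguments.
Unset Strict Implicit.
Unset Printing Implicit Defensive.
Import GRing.Theory.
Local Open Scope ring_scope.

(* [linfun f] is specified only when f is linear, and [bilfun f] only when f is
   bilinear; the lemmas [...E] below show that every use has the intended
   values. *)

Lemma linfunE (K : fieldType) (U W : vectType K) (f : U -> W) :
  linear f -> linfun f =1 f.
Proof.
move=> fL x.
pose g : {linear U -> W} := HB.pack f (GRing.isLinear.Build K U W *:%R f fL).
exact: (lfunE g).
Qed.

Definition is_bilinear (K : fieldType) (U V W : vectType K) (f : U -> V -> W) :
  Prop := (forall x, linear (f x)) /\ (forall y, linear (f^~ y)).

Definition bilfun (K : fieldType) (U V W : vectType K) (f : U -> V -> W) :
  'Hom(U, 'Hom(V, W)) := linfun (fun x => linfun (f x)).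

Lemma bilfunE (K : fieldType) (U V W : vectType K) (f : U -> V -> W) :
  is_bilinear f -> forall x y, bilfun f x y = f x y.
Proof.
move=> [fr fl] x y; rewrite /bilfun linfunE ?linfunE // => c u v.
by apply/lfunP=> z; rewrite add_lfunE scale_lfunE !linfunE // (fl z).
Qed.

Definition dual (K : fieldType) (V : vectType K) : vectType K := 'Hom(V, K^o).

Definition bas (K : fieldType) (V : vectType K) (i : 'I_(\dim {:V})) : V :=
  (vbasis {:V})`_i.

Definition dbas (K : fieldType) (V : vectType K) (i : 'I_(\dim {:V})) : dual V :=
  linfun (coord (vbasis {:V}) i : V -> K^o).

Lemma dbasE (K : fieldType) (V : vectType K) (i : 'I_(\dim {:V})) (v : V) :
  dbas i v = coord (vbasis {:V}) i v.
Proof. by rewrite linfunE // => c x y; rewrite linearP. Qed.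

Lemma bas_sum (K : fieldType) (V : vectType K) (v : V) :
  v = \sum_i dbas i v *: bas i.
Proof.
rewrite {1}(coord_vbasis (memvf v)).
by apply: eq_bigr => i _; rewrite dbasE.
Qed.

Lemma dbas_bas (K : fieldType) (V : vectType K) (i j : 'I_(\dim {:V})) :
  dbas i (bas j) = (i == j)%:R.
Proof.
by rewrite dbasE (coord_free j i (basis_free (vbasisP {:V}))) eq_sym.
Qed.

(* U (x) V is modelled as Hom(U^*, V), with u (x) v : f |-> f(u) v; its
   universal property is pure_bilinear, tlift_linear, tlift_pure and tens_ext.
   A threefold tensor power is tens B (tens B B). *)
Definition tens (K : fieldType) (U V : vectType K) : vectType K :=
  'Hom(dual U, V).

Definition pure (K : fieldType) (U V : vectType K) (u : U) (v : V) : tens U V :=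
  linfun (fun f : dual U => (f u : K) *: v).

Definition tlift (K : fieldType) (U V W : vectType K) (f : U -> V -> W)
  (t : tens U V) : W := \sum_i f (bas i) (t (dbas i)).

Declare Scope tens_scope.
Delimit Scope tens_scope with tens.
Infix "⊗" := pure (at level 40, left associativity) : tens_scope.
Local Open Scope tens_scope.

Lemma pureE (K : fieldType) (U V : vectType K) (u : U) (v : V) (f : dual U) :
  (u ⊗ v) f = (f u : K) *: v.
Proof.
rewrite linfunE // => c g h.
by rewrite add_lfunE scale_lfunE scalerDl -scalerA.
Qed.

Lemma pure_bilinear (K : fieldType) (U V : vectType K) :
  is_bilinear (@pure K U V).
Proof.
split=> [u c v w|v c u w]; apply/lfunP=> f;
  rewrite add_lfunE scale_lfunE !pureE.
  by rewrite scalerDr !scalerA mulrC.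
by rewrite linearP scalerDl -scalerA.
Qed.

Lemma pureDl (K : fieldType) (U V : vectType K) (c : K) (u w : U) (v : V) :
  (c *: u + w) ⊗ v = c *: (u ⊗ v) + w ⊗ v.
Proof. by have [_ ->] := @pure_bilinear K U V. Qed.

Lemma pureDr (K : fieldType) (U V : vectType K) (c : K) (u : U) (v w : V) :
  u ⊗ (c *: v + w) = c *: (u ⊗ v) + u ⊗ w.
Proof. by have [-> _] := @pure_bilinear K U V. Qed.

Lemma tlift_linear (K : fieldType) (U V W : vectType K) (f : U -> V -> W) :
  is_bilinear f -> linear (tlift f).
Proof.
move=> [fr _] c s t; rewrite /tlift scaler_sumr -big_split /=.
by apply: eq_bigr => i _; rewrite add_lfunE scale_lfunE fr.
Qed.

Lemma tlift_pure (K : fieldType) (U V W : vectType K) (f : U -> V -> W) :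
  is_bilinear f -> forall u v, tlift f (u ⊗ v) = f u v.
Proof.
move=> [fr fl] u v; rewrite /tlift.
pose g : {linear U -> W} :=
  HB.pack (f^~ v) (GRing.isLinear.Build K U W *:%R (f^~ v) (fl v)).
transitivity (g u) => //; rewrite [in RHS](bas_sum u) linear_sum.
apply: eq_bigr => i _; rewrite pureE linearZ /=.
by rewrite -!(linfunE (fr (bas i))) linearZ.
Qed.

Lemma tlift_sum (K : fieldType) (U V W : vectType K) (f : U -> V -> W) :
  is_bilinear f -> forall (I : Type) (s : seq I) (F : I -> tens U V),
  tlift f (\sum_(i <- s) F i) = \sum_(i <- s) tlift f (F i).
Proof.
move=> fb I s F; rewrite -(linfunE (tlift_linear fb)) linear_sum.
by apply: eq_bigr => i _ /=; rewrite linfunE //; apply: tlift_linear.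
Qed.

Lemma tens_decomp (K : fieldType) (U V : vectType K) (t : tens U V) :
  t = \sum_i bas i ⊗ t (dbas i).
Proof.
apply/lfunP=> f; rewrite sum_lfunE.
have -> : f = \sum_i (f (bas i) : K) *: dbas i.
  apply/lfunP=> u; rewrite {1}(bas_sum u) linear_sum sum_lfunE.
  by apply: eq_bigr => i _; rewrite linearZ scale_lfunE /= /GRing.scale /= mulrC.
rewrite linear_sum; apply: eq_bigr => i _; rewrite linearZ pureE; congr (_ *: _).
rewrite sum_lfunE (bigD1 i) //= scale_lfunE dbas_bas eqxx big1 ?addr0.
  by rewrite /GRing.scale /= mulr1.
by move=> j ji; rewrite scale_lfunE dbas_bas (negPf ji) scaler0.
Qed.

Lemma tens_ext (K : fieldType) (U V W : vectType K) (g h : tens U V -> W) :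
  linear g -> linear h -> (forall u v, g (u ⊗ v) = h (u ⊗ v)) -> g =1 h.
Proof.
move=> gL hL gh t; rewrite -(linfunE gL) -(linfunE hL) (tens_decomp t).
rewrite !linear_sum; apply: eq_bigr => i _ /=.
by rewrite !linfunE.
Qed.

Definition flip (K : fieldType) (U V : vectType K) : tens U V -> tens V U :=
  tlift (fun u v => v ⊗ u).

Definition is_novikov (K : fieldType) (A : vectType K)
    (m : 'Hom(A, 'End(A))) : Prop :=
  (forall a b c, m (m a b) c - m a (m b c) = m (m b a) c - m b (m a c)) /\
  (forall a b c, m (m a b) c = m (m a c) b).

(* The left multiplication operator L_A is m itself. *)
Definition rmult (K : fieldType) (A : vectType K) (m : 'Hom(A, 'End(A))) :
  'Hom(A, 'End(A)) := bilfun (fun a b => m b a).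

Lemma rmultE (K : fieldType) (A : vectType K) (m : 'Hom(A, 'End(A))) a b :
  rmult m a b = m b a.
Proof.
rewrite bilfunE //; split=> x c u v; last by rewrite linearP.
by rewrite linearP add_lfunE scale_lfunE.
Qed.

Definition is_bimodule (K : fieldType) (A V : vectType K)
    (m : 'Hom(A, 'End(A))) (l r : 'Hom(A, 'End(V))) : Prop :=
  [/\ forall a b v, l (m a b - m b a) v = l a (l b v) - l b (l a v),
      forall a b v, l a (r b v) - r b (l a v) = r (m a b) v - r b (r a v),
      forall a b v, l (m a b) v = r b (l a v) &
      forall a b v, r a (r b v) = r b (r a v)].

Lemma regular_bimodule (K : fieldType) (A : vectType K) (m : 'Hom(A, 'End(A))) :
  is_novikov m -> is_bimodule m m (rmult m).
Proof.
move=> [m1 m2]; split=> a b v; rewrite ?rmultE //.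
  rewrite linearB add_lfunE opp_lfunE.
  have -> : m (m a b) v = m (m b a) v - m b (m a v) + m a (m b v).
    by rewrite -m1 subrK.
  by rewrite addrAC (addrAC (m (m b a) v)) subrr sub0r addrC.
by rewrite -[LHS]opprB -[RHS]opprB m1.
Qed.

Definition dual_rep (K : fieldType) (A V : vectType K)
    (phi : 'Hom(A, 'End(V))) : 'Hom(A, 'End(dual V)) :=
  bilfun (fun a (f : dual V) => (- (f \o phi a)%VF : dual V)).

Lemma dual_repE (K : fieldType) (A V : vectType K) (phi : 'Hom(A, 'End(V)))
    (a : A) (f : dual V) (v : V) :
  dual_rep phi a f v = - f (phi a v).
Proof.
rewrite bilfunE ?opp_lfunE ?comp_lfunE //; split=> x c u w; apply/lfunP=> z.
  rewrite !(add_lfunE, scale_lfunE, opp_lfunE, comp_lfunE).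
  by rewrite scalerN opprD.
rewrite !(add_lfunE, scale_lfunE, opp_lfunE, comp_lfunE) linearP.
by rewrite add_lfunE scale_lfunE !linearP.
Qed.

Definition semidirect (K : fieldType) (A W : vectType K)
    (m : 'Hom(A, 'End(A))) (l r : 'Hom(A, 'End(W))) :
  'Hom((A * W)%type, 'End((A * W)%type)) :=
  bilfun (fun x y : (A * W)%type => (m x.1 y.1, l x.1 y.2 + r y.1 x.2)).

Lemma semidirectE (K : fieldType) (A W : vectType K) (m : 'Hom(A, 'End(A)))
    (l r : 'Hom(A, 'End(W))) (a b : A) (f g : W) :
  semidirect m l r (a, f) (b, g) = (m a b, l a g + r b f).
Proof.
rewrite bilfunE //; split=> -[x1 x2] c [u1 u2] [v1 v2];
  apply: injective_projections => /=;
  rewrite !linearP ?(add_lfunE, scale_lfunE) //.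
  by rewrite scalerDr addrACA.
by rewrite scalerDr addrACA.
Qed.

(* A |x_{l_star^*, -r^*} V^* for the bimodule (V, l, r). *)
Definition dual_semidirect (K : fieldType) (A V : vectType K)
    (m : 'Hom(A, 'End(A))) (l r : 'Hom(A, 'End(V))) :
  'Hom((A * dual V)%type, 'End((A * dual V)%type)) :=
  semidirect m (dual_rep (l + r)) (- dual_rep r).


Lemma dual_semidirect_novikov (K : fieldType) (A V : vectType K)
    (m : 'Hom(A, 'End(A))) (l r : 'Hom(A, 'End(V))) :
  is_novikov m -> is_bimodule m l r -> is_novikov (dual_semidirect m l r).
Proof.
move=> [m1 m2] [b1 b2 b3 b4].
have lrE a b v : l a (r b v) = r (m a b) v + l (m a b) v - r a (r b v).
  by rewrite -[LHS](subrK (r b (l a v))) b2 b3 b4 addrAC.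
have llE a b v : l b (l a v) = l a (l b v) - l (m a b) v + l (m b a) v.
  rewrite -[LHS](subKr (l a (l b v))) -b1 linearB add_lfunE opp_lfunE.
  by rewrite opprB addrA addrAC.
have fD (f : dual V) x y : f (x + y) = (f x : K) + (f y : K) by rewrite linearD.
have fN (f : dual V) x : f (- x) = - (f x : K) by rewrite linearN.
have lrsE a (f : dual V) v :
    dual_rep (l + r) a f v = - (f (l a v) : K) - (f (r a v) : K).
  by rewrite dual_repE !add_lfunE linearD opprD.
have rsE a (f : dual V) v : (- dual_rep r) a f v = (f (r a v) : K).
  by rewrite !opp_lfunE dual_repE opprK.
have addE (f g : dual V) v : (f + g) v = (f v : K) + (g v : K).
  by rewrite add_lfunE.
have oppE (f : dual V) v : (- f) v = - (f v : K) by rewrite opp_lfunE.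
split=> -[a f] [b g] [c h]; rewrite /dual_semidirect !semidirectE;
  apply: injective_projections; do ?[exact: m1 | exact: m2];
  apply/lfunP=> v; rewrite /= !(addE, oppE, lrsE, rsE).
  rewrite (llE a b) -!b3 !lrE !(b4 b a) !(b4 c _) !(fD, fN).
 
  ring.
by rewrite !lrE !(b4 c b) !(fD, fN); ring.
Qed.

(* The tensor in V^* (x) A of a linear map V -> A: the unique one whose pairing
   with v (x) a^* is <a^*, gamma v>. *)
Definition hom_tens (K : fieldType) (V A : vectType K) (gamma : 'Hom(V, A)) :
  tens (dual V) A := \sum_i dbas i ⊗ gamma (bas i).

Definition tpair (K : fieldType) (V A : vectType K) (t : tens (dual V) A)
  (v : V) (g : dual A) : K^o := tlift (fun (f : dual V) a => f v * g a : K^o) t.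

Lemma tpair_bilinear (K : fieldType) (V A : vectType K) (v : V) (g : dual A) :
  is_bilinear (fun (f : dual V) a => f v * g a : K^o).
Proof.
split=> [f c a b|a c f h]; first by rewrite linearP mulrDr scalerAr.
by rewrite add_lfunE scale_lfunE mulrDl scalerAl.
Qed.

Lemma hom_tensP (K : fieldType) (V A : vectType K) (gamma : 'Hom(V, A))
    (t : tens (dual V) A) :
  (forall v g, tpair t v g = g (gamma v)) <-> t = hom_tens gamma.
Proof.
have pE v g : tpair (hom_tens gamma) v g = g (gamma v).
  rewrite /tpair /hom_tens (tlift_sum (tpair_bilinear v g)).
  rewrite {2}(bas_sum v) !linear_sum; apply: eq_bigr => i _.
  by rewrite (tlift_pure (tpair_bilinear v g)) !linearZ.
split=> [tE|-> //]; apply/lfunP=> Phi.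
pose v : V := \sum_i (Phi (dbas i) : K) *: bas i.
have PhiE f : Phi f = f v.
  have -> : f = \sum_i (f (bas i) : K) *: dbas i.
    apply/lfunP=> u; rewrite {1}(bas_sum u) linear_sum sum_lfunE.
    by apply: eq_bigr => i _; rewrite linearZ scale_lfunE /= /GRing.scale /= mulrC.
  rewrite linear_sum sum_lfunE; apply: eq_bigr => i _.
  rewrite linearZ scale_lfunE; congr (_ *: _).
  rewrite /v linear_sum (bigD1 i) //= linearZ /= dbas_bas eqxx big1 ?addr0.
    by rewrite /GRing.scale /= mulr1.
  by move=> j ji; rewrite linearZ /= dbas_bas eq_sym (negPf ji) scaler0.
have evE s g : tpair s v g = g (s Phi).
  rewrite /tpair {1}(tens_decomp s) (tlift_sum (tpair_bilinear v g)).
  rewrite {2}(tens_decomp s) sum_lfunE linear_sum; apply: eq_bigr => i _.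
  by rewrite (tlift_pure (tpair_bilinear v g)) pureE linearZ PhiE.
rewrite (bas_sum (t Phi)) (bas_sum (hom_tens gamma Phi)).
by apply: eq_bigr => i _; rewrite -!evE tE pE.
Qed.

(* The same tensor inside B (x) B, where B = A + V^* . *)
Definition check (K : fieldType) (V A : vectType K) (gamma : 'Hom(V, A)) :
    tens (A * dual V)%type (A * dual V)%type :=
  tlift (fun f a => (0, f) ⊗ (a, 0)) (hom_tens gamma).

Lemma checkE (K : fieldType) (V A : vectType K) (gamma : 'Hom(V, A)) :
  check gamma = \sum_i (0, dbas i) ⊗ (gamma (bas i), 0).
Proof.
have bil : is_bilinear (fun (f : dual V) (a : A) =>
    ((0, f) : (A * dual V)%type) ⊗ ((a, 0) : (A * dual V)%type)).
  split=> [f c a b|a c f h].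
    rewrite -pureDr; congr (_ ⊗ _).
    by apply: injective_projections => //=; rewrite scaler0 addr0.
  rewrite -pureDl; congr (_ ⊗ _).
  by apply: injective_projections => //=; rewrite scaler0 addr0.
rewrite /check /hom_tens (tlift_sum bil).
by apply: eq_bigr => i _; rewrite (tlift_pure bil).
Qed.

(* As an operator from B^* = A^* + V to B = A + V^*, [check gamma] sends
   a^* + u to gamma u. *)
Lemma check_op (K : fieldType) (V A : vectType K) (gamma : 'Hom(V, A)) (u : V)
    (phi : dual (A * dual V)%type) :
  (forall f : dual V, phi (0, f) = f u) -> check gamma phi = (gamma u, 0).
Proof.
move=> phiE; rewrite checkE sum_lfunE [in RHS](bas_sum u) linear_sum.
apply: injective_projections.
  rewrite (raddf_sum fst) /=; apply: eq_bigr => i _.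
  by rewrite pureE phiE /= [RHS]linearZ.
rewrite (raddf_sum snd) /= big1 // => i _.
by rewrite pureE /= scaler0.
Qed.

(* For r = sum x_i (x) y_i and s = sum x'_j (x) y'_j these are r_13 o s_23,
   r_12 * s_23 and r_13 o s_12; see the lemmas [...E] below. *)
Definition mul_13_23 (K : fieldType) (B : vectType K) (m : 'Hom(B, 'End(B)))
    (r s : tens B B) : tens B (tens B B) :=
  tlift (fun x y => tlift (fun x' y' => x ⊗ (x' ⊗ m y y')) s) r.

Definition star_12_23 (K : fieldType) (B : vectType K) (m : 'Hom(B, 'End(B)))
    (r s : tens B B) : tens B (tens B B) :=
  tlift (fun x y => tlift (fun x' y' => x ⊗ ((m y x' + m x' y) ⊗ y')) s) r.

Definition mul_13_12 (K : fieldType) (B : vectType K) (m : 'Hom(B, 'End(B)))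
    (r s : tens B B) : tens B (tens B B) :=
  tlift (fun x y => tlift (fun x' y' => m x x' ⊗ (y' ⊗ y)) s) r.

Lemma tlift2_sum (K : fieldType) (B W : vectType K) (F : B -> B -> B -> B -> W) :
  [/\ forall y x' y', linear (fun x => F x y x' y'),
      forall x x' y', linear (fun y => F x y x' y'),
      forall x y y', linear (fun x' => F x y x' y') &
      forall x y x', linear (F x y x')] ->
  forall (p q : nat) (x y : 'I_p -> B) (x' y' : 'I_q -> B),
  tlift (fun a b => tlift (F a b) (\sum_j x' j ⊗ y' j)) (\sum_i x i ⊗ y i) =
  \sum_i \sum_j F (x i) (y i) (x' j) (y' j).
Proof.
move=> [F1 F2 F3 F4] p q x y x' y'.
have bil a b : is_bilinear (F a b) by split=> *; [apply: F4 | apply: F3].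
rewrite tlift_sum.
  apply: eq_bigr => i _; rewrite tlift_pure.
    rewrite (tlift_sum (bil _ _)); apply: eq_bigr => j _.
    exact: (tlift_pure (bil _ _)).
  split=> a c u v; rewrite /tlift scaler_sumr -big_split; apply: eq_bigr => j _.
    exact: F2.
  exact: F1.
split=> a c u v; rewrite /tlift scaler_sumr -big_split; apply: eq_bigr => j _.
  exact: F2.
exact: F1.
Qed.

Lemma mul_13_23E (K : fieldType) (B : vectType K) (m : 'Hom(B, 'End(B)))
    (p q : nat) (x y : 'I_p -> B) (x' y' : 'I_q -> B) :
  mul_13_23 m (\sum_i x i ⊗ y i) (\sum_j x' j ⊗ y' j) =
  \sum_i \sum_j x i ⊗ (x' j ⊗ m (y i) (y' j)).
Proof.
apply: (@tlift2_sum _ _ _ (fun x y x' y' => x ⊗ (x' ⊗ m y y'))).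
by split=> a b d c u v; rewrite ?linearP ?add_lfunE ?scale_lfunE ?(pureDl, pureDr).
Qed.

Lemma star_12_23E (K : fieldType) (B : vectType K) (m : 'Hom(B, 'End(B)))
    (p q : nat) (x y : 'I_p -> B) (x' y' : 'I_q -> B) :
  star_12_23 m (\sum_i x i ⊗ y i) (\sum_j x' j ⊗ y' j) =
  \sum_i \sum_j x i ⊗ ((m (y i) (x' j) + m (x' j) (y i)) ⊗ y' j).
Proof.
apply: (@tlift2_sum _ _ _
  (fun x y x' y' => x ⊗ ((m y x' + m x' y) ⊗ y'))).
split=> a b d c u v; rewrite ?linearP ?add_lfunE ?scale_lfunE ?(pureDl, pureDr) //.
  by rewrite addrACA -scalerDr pureDl pureDr.
by rewrite addrACA -scalerDr pureDl pureDr.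
Qed.

Lemma mul_13_12E (K : fieldType) (B : vectType K) (m : 'Hom(B, 'End(B)))
    (p q : nat) (x y : 'I_p -> B) (x' y' : 'I_q -> B) :
  mul_13_12 m (\sum_i x i ⊗ y i) (\sum_j x' j ⊗ y' j) =
  \sum_i \sum_j m (x i) (x' j) ⊗ (y' j ⊗ y i).
Proof.
apply: (@tlift2_sum _ _ _ (fun x y x' y' => m x x' ⊗ (y' ⊗ y))).
by split=> a b d c u v; rewrite ?linearP ?add_lfunE ?scale_lfunE ?(pureDl, pureDr).
Qed.

Definition ext_nybe (K : fieldType) (B : vectType K) (m : 'Hom(B, 'End(B)))
    (epsilon : K) (r : tens B B) : Prop :=
  mul_13_23 m r r + star_12_23 m r r + mul_13_12 m r r =
  epsilon *: mul_13_23 m (r + flip r) (r + flip r).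

Definition nybe (K : fieldType) (B : vectType K) (m : 'Hom(B, 'End(B)))
  (r : tens B B) : Prop := ext_nybe m 0 r.

Definition skew_symmetric (K : fieldType) (B : vectType K) (r : tens B B) :
  Prop := flip r = - r.

Definition balanced (K : fieldType) (A V : vectType K)
    (l r : 'Hom(A, 'End(V))) (beta : 'Hom(V, A)) : Prop :=
  forall u v, l (beta u) v = r (beta v) u.

Definition bimodule_hom (K : fieldType) (A V : vectType K)
    (m : 'Hom(A, 'End(A))) (l r : 'Hom(A, 'End(V))) (beta : 'Hom(V, A)) :
    Prop :=
  (forall x u, beta (l x u) = m x (beta u)) /\
  (forall x u, beta (r x u) = m (beta u) x).

Definition invariant (K : fieldType) (A V : vectType K)
    (m : 'Hom(A, 'End(A))) (l r : 'Hom(A, 'End(V))) (kappa : K)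
    (beta : 'Hom(V, A)) : Prop :=
  (forall x u, kappa *: beta (l x u) = kappa *: m x (beta u)) /\
  (forall x u, kappa *: beta (r x u) = kappa *: m (beta u) x).

(* Extended O-operator of weight 0 with extension beta of mass (kappa, 0). *)
Definition ext_O_operator (K : fieldType) (A V : vectType K)
    (m : 'Hom(A, 'End(A))) (l r : 'Hom(A, 'End(V))) (kappa : K)
    (beta alpha : 'Hom(V, A)) : Prop :=
  [/\ balanced l r beta, invariant m l r kappa beta &
      forall u v,
        m (alpha u) (alpha v) - alpha (l (alpha u) v + r (alpha v) u) =
        kappa *: m (beta u) (beta v)].

Definition O_operator (K : fieldType) (A V : vectType K)
    (m : 'Hom(A, 'End(A))) (l r : 'Hom(A, 'End(V))) (alpha : 'Hom(V, A)) :
    Prop :=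
  forall u v, m (alpha u) (alpha v) = alpha (l (alpha u) v + r (alpha v) u).

Definition rota_baxter (K : fieldType) (A : vectType K)
    (m : 'Hom(A, 'End(A))) (lambda : K) (T : 'End(A)) : Prop :=
  forall x y, m (T x) (T y) = T (m (T x) y + m x (T y) + lambda *: m x y).

(* Main.v *)
(* A tensor in B (x) B is viewed as an operator B^* -> B, which turns the extended
   Novikov Yang-Baxter equation into an identity between elements of B indexed by
   two functionals.  For B = A + V^* a functional is a pair (p, u) in A^* + V, and
   r = check g + tau (check d) sends (p, u) to (g u, p o d).  Separating the
   A-component from the V^*-component, and in the latter the terms in the two
   A^*-arguments, leaves three identities in A.  For g = alpha + beta and
   d = beta - alpha, with beta a balanced bimodule homomorphism, each of them
   follows from the defining identity of extended O-operators, and the first one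
   is equivalent to it.  A Rota-Baxter operator T of nonzero weight lambda
   corresponds to alpha = (2 / lambda) T + id and beta = id. *)
Require Import Defs.
From mathcomp Require Import all_boot all_algebra ring.
Set Implicit Arguments.
Unset Strict Implicit.
Unset Printing Implicit Defensive.
Import GRing.Theory.
Local Open Scope ring_scope.
Local Open Scope tens_scope.

(** * Linear maps, separation by functionals, and the flip *)

Lemma homZ (K : fieldType) (U V : vectType K) (f : 'Hom(U, V)) c x :
  f (c *: x) = c *: f x.
Proof. exact: linearZ. Qed.

Lemma homD (K : fieldType) (U V : vectType K) (f : 'Hom(U, V)) x y :
  f (x + y) = f x + f y.
Proof. exact: linearD. Qed.

Lemma homN (K : fieldType) (U V : vectType K) (f : 'Hom(U, V)) x :
  f (- x) = - f x.
Proof. exact: linearN. Qed.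

Lemma hom0 (K : fieldType) (U V : vectType K) (f : 'Hom(U, V)) : f 0 = 0.
Proof. exact: linear0. Qed.

Lemma hom_sum (K : fieldType) (U V : vectType K) (f : 'Hom(U, V)) (I : Type)
    (s : seq I) (F : I -> U) :
  f (\sum_(i <- s) F i) = \sum_(i <- s) f (F i).
Proof. exact: linear_sum. Qed.

(** The coordinate functionals already determine a vector. This turns identities in [A] into scalar
    ones, which [ring] and [field] can settle. *)
Lemma eq_dual (K : fieldType) (V : vectType K) (x y : V) :
  (forall f : dual V, f x = f y) -> x = y.
Proof. by move=> e; rewrite (bas_sum x) (bas_sum y); under eq_bigr do rewrite e. Qed.

Lemma tens_decompE (K : fieldType) (U V : vectType K) (t : tens U V) (f : dual U) :
  t f = \sum_i (f (bas i) : K) *: t (dbas i).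
Proof.
by rewrite [in LHS](tens_decomp t) sum_lfunE; apply: eq_bigr => i _; rewrite pureE.
Qed.

Lemma flip_bilinear (K : fieldType) (U V : vectType K) :
  is_bilinear (fun (u : U) (v : V) => v ⊗ u).
Proof. by split=> [u c v w|v c u w]; [exact: pureDl | exact: pureDr]. Qed.

Lemma flip_linear (K : fieldType) (U V : vectType K) : linear (@flip K U V).
Proof. exact: tlift_linear (@flip_bilinear K U V). Qed.

Lemma flipD (K : fieldType) (U V : vectType K) (s t : tens U V) :
  flip (s + t) = flip s + flip t.
Proof. by rewrite -[s]scale1r flip_linear !scale1r. Qed.

Lemma flip0 (K : fieldType) (U V : vectType K) : flip (0 : tens U V) = 0.
Proof. by apply: (addIr (flip 0)); rewrite -flipD !add0r. Qed.

Lemma flipZ (K : fieldType) (U V : vectType K) c (t : tens U V) :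
  flip (c *: t) = c *: flip t.
Proof. by rewrite -[c *: t]addr0 flip_linear flip0 addr0. Qed.

Lemma flipN (K : fieldType) (U V : vectType K) (t : tens U V) :
  flip (- t) = - flip t.
Proof. by rewrite -scaleN1r flipZ scaleN1r. Qed.

Lemma flip_pure (K : fieldType) (U V : vectType K) (u : U) (v : V) :
  flip (u ⊗ v) = v ⊗ u.
Proof. exact: (tlift_pure (@flip_bilinear K U V)). Qed.

Lemma flip_sum (K : fieldType) (U V : vectType K) (I : Type) (s : seq I)
    (F : I -> tens U V) :
  flip (\sum_(i <- s) F i) = \sum_(i <- s) flip (F i).
Proof. exact: (tlift_sum (@flip_bilinear K U V)). Qed.

Lemma flipK (K : fieldType) (U V : vectType K) (t : tens U V) :
  flip (flip t) = t.
Proof.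
rewrite (tens_decomp t) !flip_sum.
by apply: eq_bigr => i _; rewrite !flip_pure.
Qed.

Lemma flipE (K : fieldType) (U V : vectType K) (t : tens U V) (g : dual V) :
  flip t g = \sum_i (g (t (dbas i)) : K) *: bas i.
Proof.
rewrite {1}(tens_decomp t) flip_sum sum_lfunE.
by apply: eq_bigr => i _; rewrite flip_pure pureE.
Qed.

(** * The Yang-Baxter equation as an identity of operators *)

Lemma mul_13_23_op (K : fieldType) (B : vectType K) (m : 'Hom(B, 'End(B)))
    (r s : tens B B) (f g : dual B) :
  mul_13_23 m r s f g = m (r f) (s g).
Proof.
rewrite {1}(tens_decomp r) {1}(tens_decomp s) mul_13_23E.
rewrite (tens_decompE r) (tens_decompE s) !sum_lfunE.
rewrite [m (\sum_i _)]hom_sum sum_lfunE; apply: eq_bigr => i _.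
rewrite !sum_lfunE hom_sum; apply: eq_bigr => j _.
by rewrite pureE scale_lfunE pureE !homZ scale_lfunE !scalerA mulrC.
Qed.

(** Feeding [f] to the first factor contracts [r] to [r f]. Pairing the middle factor with [g] then
    leaves a functional of the first leg of [s], and [s] is evaluated at that functional. *)
Lemma star_12_23_op (K : fieldType) (B : vectType K) (m : 'Hom(B, 'End(B)))
    (r s : tens B B) (f g : dual B) :
  star_12_23 m r s f g = s (g \o (m (r f) + rmult m (r f)))%VF.
Proof.
rewrite {1}(tens_decomp r) {1}(tens_decomp s) star_12_23E.
rewrite (tens_decompE s) !sum_lfunE.
under eq_bigr do rewrite !sum_lfunE.
rewrite exchange_big.
apply: eq_bigr => j _ /=.
rewrite comp_lfunE add_lfunE rmultE (tens_decompE r) !hom_sum.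
rewrite !sum_lfunE -big_split hom_sum scaler_suml /=.
apply: eq_bigr => i _.
rewrite pureE scale_lfunE pureE !homZ scale_lfunE -scalerDr homZ.
by rewrite scalerA.
Qed.

(** Here [g] meets the second leg of [s], so the first leg contracts to [flip s g]. What [f] sees is
    then right multiplication of the first leg of [r] by this element. *)
Lemma mul_13_12_op (K : fieldType) (B : vectType K) (m : 'Hom(B, 'End(B)))
    (r s : tens B B) (f g : dual B) :
  mul_13_12 m r s f g = r (f \o rmult m (flip s g))%VF.
Proof.
rewrite {1}(tens_decomp r) {1}(tens_decomp s) mul_13_12E.
rewrite flipE (tens_decompE r) !sum_lfunE.
apply: eq_bigr => i _ /=.
rewrite comp_lfunE rmultE !hom_sum /= scaler_suml !sum_lfunE.
apply: eq_bigr => j _.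
rewrite pureE scale_lfunE pureE !homZ /= scalerA.
by rewrite mulrC.
Qed.

(** A threefold tensor is determined by its values at pairs of functionals, one for each of the
    first two factors, so the equation can be tested in [B]. *)
Lemma ext_nybe_op (K : fieldType) (B : vectType K) (m : 'Hom(B, 'End(B)))
    (e : K) (r : tens B B) :
  ext_nybe m e r <-> forall f g : dual B,
    m (r f) (r g) + r (g \o (m (r f) + rmult m (r f)))%VF
      + r (f \o rmult m (flip r g))%VF
    = e *: m (r f + flip r f) (r g + flip r g).
Proof.
split=> [E f g | E].
  rewrite -mul_13_23_op -star_12_23_op -mul_13_12_op -!add_lfunE E.
  by rewrite !scale_lfunE mul_13_23_op !add_lfunE.
apply/lfunP=> f; apply/lfunP=> g.
rewrite !add_lfunE !scale_lfunE !mul_13_23_op star_12_23_op mul_13_12_op.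
by rewrite !add_lfunE E.
Qed.

(** * Functionals on [A + V^*] as pairs from [A^*] and [V] *)

Definition dual_pair (K : fieldType) (A V : vectType K) (p : dual A) (u : V) :
  dual (A * dual V)%type := linfun (fun x : (A * dual V)%type => p x.1 + x.2 u).

Lemma dual_pairE (K : fieldType) (A V : vectType K) (p : dual A) (u : V) a f :
  dual_pair p u (a, f) = p a + f u.
Proof.
rewrite linfunE // => c x y /=.
by rewrite add_lfunE scale_lfunE linearP scalerDr addrACA.
Qed.

(** Finite dimension enters here: the restriction of [phi] to [V^*] is evaluation at the vector
    whose coordinates are the values of [phi] on the dual basis. *)
Lemma dual_pair_surj (K : fieldType) (A V : vectType K)
    (phi : dual (A * dual V)%type) :
  exists p u, phi = dual_pair p u.
Proof.
have pL : linear (fun a => phi (a, 0) : K^o).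
  move=> c a b; rewrite -linearP; congr (phi _).
  by apply: injective_projections => //=; rewrite scaler0 addr0.
have qL : linear (fun f => phi (0, f) : K^o).
  move=> c f g; rewrite -linearP; congr (phi _).
  by apply: injective_projections => //=; rewrite scaler0 addr0.
exists (linfun (fun a => phi (a, 0) : K^o)).
exists (\sum_i (phi (0, dbas i) : K) *: bas i).
apply/lfunP=> -[a f]; rewrite dual_pairE linfunE //.
have -> : phi (a, f) = phi (a, 0) + phi (0, f).
  rewrite -linearD; congr (phi _).
  by apply: injective_projections; rewrite /= ?addr0 ?add0r.
congr (_ + _); rewrite -(linfunE qL).
have -> : f = \sum_i (f (bas i) : K) *: dbas i.
  apply/lfunP=> u; rewrite {1}(bas_sum u) linear_sum sum_lfunE.
  by apply: eq_bigr => i _; rewrite linearZ scale_lfunE /= /GRing.scale /= mulrC.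
rewrite !hom_sum /=; apply: eq_bigr => i _.
rewrite !homZ linfunE //= sum_lfunE (bigD1 i) //= big1.
  by rewrite scale_lfunE dbas_bas eqxx addr0 /GRing.scale /= mulr1 mulrC.
by move=> j ji; rewrite scale_lfunE dbas_bas (negPf ji) scaler0.
Qed.

(** * The operators of [check g] and of its flip *)

Section CheckOperator.
Variables (K : fieldType) (A V : vectType K).
Implicit Types (g d : 'Hom(V, A)) (p : dual A) (u v w : V).

Lemma check_pair g p u : check g (dual_pair p u) = (g u, 0).
Proof. by apply: check_op => f; rewrite dual_pairE linear0 add0r. Qed.

(** Flipping a tensor transposes its operator: [flip (check d)] ignores [u] and applies the
    transpose of [d] to [p]. *)
Lemma flip_check_pair d p u :
  flip (check d) (dual_pair p u) = (0, (p \o d)%VF : dual V).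
Proof.
rewrite checkE flip_sum sum_lfunE.
apply: injective_projections.
  rewrite (raddf_sum fst) /= big1 // => i _.
  by rewrite flip_pure pureE /= scaler0.
rewrite (raddf_sum snd) /=; apply/lfunP=> w.
rewrite sum_lfunE comp_lfunE {2}(bas_sum w) !linear_sum; apply: eq_bigr => i _.
rewrite flip_pure pureE scale_lfunE /= dual_pairE lfunE addr0 !linearZ /=.
by rewrite /GRing.scale /= mulrC.
Qed.

Lemma checkP c g d : check (c *: g + d) = c *: check g + check d.
Proof.
apply/lfunP=> f; have [p [u ->]] := dual_pair_surj f.
rewrite !add_lfunE !scale_lfunE !check_pair !add_lfunE !scale_lfunE.
by apply: injective_projections; rewrite //= scaler0 addr0.
Qed.

Lemma checkD g d : check (g + d) = check g + check d.
Proof. by rewrite -[g in LHS]scale1r checkP scale1r. Qed.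

Lemma check0 : check (0 : 'Hom(V, A)) = 0.
Proof. by apply: (addIr (check 0)); rewrite -checkD !add0r. Qed.

Lemma checkZ c g : check (c *: g) = c *: check g.
Proof. by rewrite -[c *: g]addr0 checkP check0 addr0. Qed.

Lemma checkN g : check (- g) = - check g.
Proof. by rewrite -scaleN1r checkZ scaleN1r. Qed.
End CheckOperator.

(** * The equation in the semidirect product, split into components *)

Section DualSemidirect.
Variables (K : fieldType) (A V : vectType K).
Implicit Types (g d : 'Hom(V, A)) (p q : dual A) (u v w : V).

Lemma eq_pair_dual (x y : (A * dual V)%type) :
  x = y <-> x.1 = y.1 /\ forall w, x.2 w = y.2 w.
Proof.
split=> [-> //|[e1 e2]]; apply: injective_projections => //.
exact/lfunP.
Qed.

(** This and the next lemma handle functionals not given as pairs, such as composites with a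
    multiplication. The [A]-component needs only the restriction of [phi] to [V^*], and the
    [V^*]-component only its values on [A]. *)
Lemma check_flip_op1 g d u (phi : dual (A * dual V)%type) :
  (forall f : dual V, phi (0, f) = f u) ->
  ((check g + flip (check d)) phi).1 = g u.
Proof.
have [p [v ->]] := dual_pair_surj phi => h.
have -> : v = u by apply: eq_dual => f; rewrite -h dual_pairE hom0 add0r.
by rewrite add_lfunE check_pair flip_check_pair /= addr0.
Qed.

Lemma check_flip_op2 g d (phi : dual (A * dual V)%type) w :
  ((check g + flip (check d)) phi).2 w = phi (d w, 0).
Proof.
have [p [v ->]] := dual_pair_surj phi.
by rewrite add_lfunE check_pair flip_check_pair /= add0r comp_lfunE dual_pairE
  zero_lfunE addr0.
Qed.

Lemma flip_check_flip g d :
  flip (check g + flip (check d)) = check d + flip (check g).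
Proof. by rewrite flipD flipK addrC. Qed.

Lemma check_flip_pair g d p u :
  (check g + flip (check d)) (dual_pair p u) = (g u, (p \o d)%VF).
Proof.
by rewrite add_lfunE check_pair flip_check_pair; congr pair; rewrite ?addr0 ?add0r.
Qed.

Variables (m : 'Hom(A, 'End(A))) (l r : 'Hom(A, 'End(V))).
Let mV := dual_semidirect m l r.

Lemma dual_semidirect1 x y : (mV x y).1 = m x.1 y.1.
Proof. by case: x y => [a f] [b h]; rewrite /mV /dual_semidirect semidirectE. Qed.

Lemma dual_semidirect2 x y w :
  (mV x y).2 w = x.2 (r y.1 w) - y.2 (l x.1 w + r x.1 w).
Proof.
case: x y => [a f] [b h]; rewrite /mV /dual_semidirect semidirectE /=.
by rewrite !add_lfunE !opp_lfunE !dual_repE opprK !add_lfunE addrC.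
Qed.

Lemma dual_semidirect_pair p u x y :
  dual_pair p u (mV x y) =
  p (m x.1 y.1) + x.2 (r y.1 u) - y.2 (l x.1 u + r x.1 u).
Proof.
rewrite [mV x y]surjective_pairing dual_pairE dual_semidirect1 dual_semidirect2.
by rewrite addrA.
Qed.


(** On [V^*], left and right multiplication by [x] add up to the dual of [l + r] minus the dual of
    [r]. The [r] terms cancel and only the dual of [l] survives, which gives the minus sign. The
    same cancellation occurs in the next lemma. *)
Lemma star_op1 g d q v (x : (A * dual V)%type) :
  ((check g + flip (check d)) (dual_pair q v \o (mV x + rmult mV x))%VF).1
  = - g (l x.1 v).
Proof.
rewrite -homN; apply: check_flip_op1 => f.
rewrite comp_lfunE add_lfunE rmultE homD !dual_semidirect_pair /=.
rewrite !hom0 !zero_lfunE !addr0 !hom0 !homD homN subr0 !add0r opprD.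
by rewrite subrK.
Qed.

Lemma star_op2 g d q v (x : (A * dual V)%type) w :
  ((check g + flip (check d)) (dual_pair q v \o (mV x + rmult mV x))%VF).2 w
  = q (m x.1 (d w) + m (d w) x.1) - x.2 (l (d w) v).
Proof.
rewrite check_flip_op2 comp_lfunE add_lfunE rmultE homD !dual_semidirect_pair /=.
rewrite !zero_lfunE !homD.
have -> : x.2 (l (d w) v) = (x.2 (l (d w) v) : K) by [].
ring.
Qed.

Lemma rmult_op1 g d p u (y : (A * dual V)%type) :
  ((check g + flip (check d)) (dual_pair p u \o rmult mV y)%VF).1 = g (r y.1 u).
Proof.
apply: check_flip_op1 => f.
rewrite comp_lfunE rmultE dual_semidirect_pair /=.
by rewrite !hom0 !zero_lfunE !addr0 !hom0 subr0 add0r.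
Qed.

Lemma rmult_op2 g d p u (y : (A * dual V)%type) w :
  ((check g + flip (check d)) (dual_pair p u \o rmult mV y)%VF).2 w
  = p (m (d w) y.1) - y.2 (l (d w) u + r (d w) u).
Proof.
by rewrite check_flip_op2 comp_lfunE rmultE dual_semidirect_pair /= zero_lfunE addr0.
Qed.

(** The [A]-component of the operator identity involves [u] and [v] only. The [V^*]-component,
    evaluated at [w], is linear in the covectors, so it collects into [p] of a vector built from [v]
    and [w] plus [q] of a vector built from [u] and [w]. *)
Lemma ext_nybe_check_at e g d p q u v (s := g + d)
    (f := dual_pair p u) (h := dual_pair q v) (t := check g + flip (check d)) :
  mV (t f) (t h) + t (h \o (mV (t f) + rmult mV (t f)))%VF
    + t (f \o rmult mV (flip t h))%VF
    = e *: mV (t f + flip t f) (t h + flip t h) <->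
  m (g u) (g v) - g (l (g u) v) + g (r (d v) u) = e *: m (s u) (s v) /\
  forall w,
    p (m (d w) (d v) - d (l (d w) v) + d (r (g v) w) - e *: s (r (s v) w))
    + q (m (g u) (d w) + m (d w) (g u)
      - d (l (g u) w + r (g u) w) - g (l (d w) u + r (d w) u)
      + e *: s (l (s u) w + r (s u) w)) = 0.
Proof.
have sE : t + flip t = check s + flip (check s).
  by rewrite flip_check_flip addrACA -flipD [check d + _]addrC -!checkD.
have -> : t f + flip t f = (s u, (p \o s)%VF).
  by rewrite -[LHS]add_lfunE sE; exact: check_flip_pair.
have -> : t h + flip t h = (s v, (q \o s)%VF).
  by rewrite -[LHS]add_lfunE sE; exact: check_flip_pair.
have -> : t f = (g u, (p \o d)%VF) by exact: check_flip_pair.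
have -> : t h = (g v, (q \o d)%VF) by exact: check_flip_pair.
have -> : flip t h = (d v, (q \o g)%VF).
  by rewrite flip_check_flip; exact: check_flip_pair.
have S1 := star_op1 g d q v (g u, (p \o d)%VF).
have S2 := star_op2 g d q v (g u, (p \o d)%VF).
have R1 := rmult_op1 g d p u (d v, (q \o g)%VF).
have R2 := rmult_op2 g d p u (d v, (q \o g)%VF).
have M1 := dual_semidirect1 (g u, (p \o d)%VF) (g v, (q \o d)%VF).
have M2 := dual_semidirect2 (g u, (p \o d)%VF) (g v, (q \o d)%VF).
have N1 := dual_semidirect1 (s u, (p \o s)%VF) (s v, (q \o s)%VF).
have N2 := dual_semidirect2 (s u, (p \o s)%VF) (s v, (q \o s)%VF).
(* Only the components of these products, and below of these tensor values, matter. The terms become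
   variables known through the component equations. *)
move: (mV (g u, _) _) (mV (s u, _) _) M1 M2 N1 N2 => x y /= M1 M2 N1 N2.
rewrite -/t -/h -/f in S1 S2 R1 R2.
move: (t (h \o _)%VF) (t (f \o _)%VF) S1 S2 R1 R2 => a b /= S1 S2 R1 R2.
clear sE; clearbody s.
rewrite eq_pair_dual /= M1 N1 S1 R1.
suff QE w : (x.2 + a.2 + b.2) w - (e *: y.2) w = 
    p (m (d w) (d v) - d (l (d w) v) + d (r (g v) w) - e *: s (r (s v) w))
    + q (m (g u) (d w) + m (d w) (g u)
      - d (l (g u) w + r (g u) w) - g (l (d w) u + r (d w) u)
      + e *: s (l (s u) w + r (s u) w)).
  split=> -[e1 hw]; split; first [exact: e1 | move=> w].
    by rewrite -QE (hw w) subrr.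
  by apply: subr0_eq; rewrite QE.
rewrite !add_lfunE scale_lfunE M2 S2 R2 N2 !comp_lfunE.
rewrite !(homD, homN, homZ).
ring.
Qed.

(** Since [p] and [q] vary independently, setting one of them to [0] isolates the vector under the
    other, and [eq_dual] makes that vector vanish. *)
Lemma ext_nybe_check e g d :
  ext_nybe mV e (check g + flip (check d)) <->
  forall u v,
  [/\ m (g u) (g v) - g (l (g u) v) + g (r (d v) u)
        = e *: m ((g + d) u) ((g + d) v),
      m (d u) (d v) - d (l (d u) v) + d (r (g v) u)
        = e *: (g + d) (r ((g + d) v) u) &
      m (g u) (d v) + m (d v) (g u)
        - d (l (g u) v + r (g u) v) - g (l (d v) u + r (d v) u)
        = - (e *: (g + d) (l ((g + d) u) v + r ((g + d) u) v))].
Proof.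
rewrite ext_nybe_op; split=> [E u v | E f h].
  split.
  - by have /ext_nybe_check_at [] := E (dual_pair 0 u) (dual_pair 0 v).
  - apply: eq_dual => p.
    have /ext_nybe_check_at [_ /(_ u)] := E (dual_pair p 0) (dual_pair 0 v).
    by rewrite zero_lfunE addr0 homD homN => /subr0_eq.
  apply: eq_dual => q.
  have /ext_nybe_check_at [_ /(_ v)] := E (dual_pair 0 u) (dual_pair q 0).
  by rewrite zero_lfunE add0r homD [q (- _)]homN => /addr0_eq <-; rewrite opprK.
have [p [u ->]] := dual_pair_surj f; have [q [v ->]] := dual_pair_surj h.
apply/ext_nybe_check_at; split=> [|w]; first by have [] := E u v.
have [_ -> _] := E w v; have [_ _ ->] := E u w.
by rewrite subrr addNr !hom0 addr0.
Qed.
End DualSemidirect.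

(** * Extended O-operators *)

Section Operators.
Variables (K : fieldType) (A V : vectType K).
Variables (m : 'Hom(A, 'End(A))) (l r : 'Hom(A, 'End(V))).

Lemma balancedN (beta : 'Hom(V, A)) : balanced l r beta -> balanced l r (- beta).
Proof. by move=> h u v; rewrite !opp_lfunE !homN !opp_lfunE h. Qed.

Lemma bimodule_homN (beta : 'Hom(V, A)) :
  bimodule_hom m l r beta -> bimodule_hom m l r (- beta).
Proof.
move=> [h1 h2]; split=> x u; rewrite !opp_lfunE homN.
  by rewrite h1.
by rewrite opp_lfunE h2.
Qed.

(** Multiplying the homomorphism identities by [kappa] gives invariance of mass [kappa], so only the
    quadratic identity remains to be compared. *)
Lemma ext_O_operatorE kappa (alpha beta : 'Hom(V, A)) :
  balanced l r beta -> bimodule_hom m l r beta ->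
  ext_O_operator m l r kappa beta alpha <->
  forall u v, m (alpha u) (alpha v) - alpha (l (alpha u) v + r (alpha v) u)
    = kappa *: m (beta u) (beta v).
Proof.
move=> hb [h1 h2]; split=> [[] //|E].
by split=> //; split=> x u; rewrite ?h1 ?h2.
Qed.

(** The mass has two sources: [g + d] is twice [beta], which gives the factor 4 on the right, and
    the left side exceeds the O-operator defect of [alpha] by one copy of the product of [beta u]
    and [beta v], which gives the shift by 1. *)
Lemma ext_nybe_extended kappa (alpha beta : 'Hom(V, A)) :
  4%:R != 0 :> K -> balanced l r beta -> bimodule_hom m l r beta ->
  ext_nybe (dual_semidirect m l r) ((kappa + 1) / 4%:R)
    (check alpha - flip (check alpha) + (check beta + flip (check beta)))
  <-> forall u v, m (alpha u) (alpha v) - alpha (l (alpha u) v + r (alpha v) u)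
    = kappa *: m (beta u) (beta v).
Proof.
move=> n4 hb [h1 h2].
(* Scaling in [K^o] is multiplication in [K]; the rewriting exposes it to [ring]. *)
have regE (c : K) (x : K^o) : c *: x = (c * x : K) by [].
set e := _ / _.
have -> : kappa = e * 4%:R - 1 by rewrite /e divfK // addrK.
have -> : check alpha - flip (check alpha) + (check beta + flip (check beta))
    = check (alpha + beta) + flip (check (beta - alpha)).
  by rewrite !checkD checkN flipD flipN addrACA [flip _ - _]addrC.
have sE : alpha + beta + (beta - alpha) = beta + beta.
  by rewrite addrC -addrA addKr.
rewrite ext_nybe_check !sE.
(* The homomorphism property cancels the mixed products of [alpha] and [beta]. Balance cancels the
   remaining terms in which [l] or [r] is taken at a value of [beta]. *)
have vva u v : m ((alpha + beta) u) ((alpha + beta) v)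
      - (alpha + beta) (l ((alpha + beta) u) v)
      + (alpha + beta) (r ((beta - alpha) v) u)
    = m (alpha u) (alpha v) - alpha (l (alpha u) v + r (alpha v) u)
      + m (beta u) (beta v).
  apply: eq_dual => f.
  rewrite !(add_lfunE, opp_lfunE, homD, homN, hb, h1, h2).
  ring.
have gdE u v : e *: m ((beta + beta) u) ((beta + beta) v)
    = (e * 4%:R) *: m (beta u) (beta v).
  apply: eq_dual => f.
  rewrite !(add_lfunE, homD, homZ) !regE.
  ring.
split=> [E u v | E u v].
  have [] := E u v; rewrite vva gdE => h _ _.
  by rewrite scalerBl scale1r -h addrK.
(* Solved for the product of two values of [alpha], the hypothesis eliminates such products from the
   two remaining identities, which then hold term by term. *)
have Ea : forall u v, m (alpha u) (alpha v) =
    (e * 4%:R - 1) *: m (beta u) (beta v) + alpha (l (alpha u) v) + alpha (r (alpha v) u).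
  by move=> x y; rewrite -E homD -addrA subrK.
split.
- by rewrite vva gdE E scalerBl scale1r subrK.
- apply: eq_dual => f.
  rewrite !(add_lfunE, opp_lfunE, homD, homN, homZ, hb, h1, h2, Ea) !regE.
  ring.
apply: eq_dual => f.
rewrite !(add_lfunE, opp_lfunE, homD, homN, homZ, hb, h1, h2, Ea) !regE.
ring.
Qed.
End Operators.

(** At [kappa = -1] the mass vanishes. *)
Lemma nybe_extended (K : fieldType) (A V : vectType K) (m : 'Hom(A, 'End(A)))
    (l r : 'Hom(A, 'End(V))) (alpha beta : 'Hom(V, A)) :
  4%:R != 0 :> K -> balanced l r beta -> bimodule_hom m l r beta ->
  nybe (dual_semidirect m l r)
    (check alpha - flip (check alpha) + (check beta + flip (check beta)))
  <-> forall u v, m (alpha u) (alpha v) - alpha (l (alpha u) v + r (alpha v) u)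
    = - m (beta u) (beta v).
Proof.
move=> n4 hb hh; have := ext_nybe_extended (-1) alpha n4 hb hh.
rewrite addNr mul0r => E; rewrite /nybe E.
by split=> h u v; rewrite h scaleN1r.
Qed.

(** The zero map is a balanced bimodule homomorphism. Taking it for [beta] removes both the
    symmetric part of the tensor and the extension term. *)
Lemma nybe_O_operator (K : fieldType) (A V : vectType K) (m : 'Hom(A, 'End(A)))
    (l r : 'Hom(A, 'End(V))) (alpha : 'Hom(V, A)) :
  4%:R != 0 :> K ->
  nybe (dual_semidirect m l r) (check alpha - flip (check alpha))
  <-> O_operator m l r alpha.
Proof.
move=> n4.
have hb : balanced l r (0 : 'Hom(V, A)).
  by move=> u v; rewrite !zero_lfunE !hom0 !zero_lfunE.
have hh : bimodule_hom m l r 0.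
  by split=> x u; rewrite !zero_lfunE !hom0 ?zero_lfunE.
have := nybe_extended alpha n4 hb hh.
rewrite check0 flip0 !addr0 => ->; split=> h u v.
  by apply: subr0_eq; rewrite h !zero_lfunE hom0 ?zero_lfunE oppr0.
by rewrite h subrr !zero_lfunE hom0 ?zero_lfunE oppr0.
Qed.

(** * Skew-symmetry, the regular bimodule and Rota-Baxter operators *)

Lemma skew_symmetric_sub_flip (K : fieldType) (B : vectType K) (t : tens B B) :
  skew_symmetric (t - flip t).
Proof. by rewrite /skew_symmetric flipD flipN flipK opprB addrC. Qed.

Lemma balanced_id (K : fieldType) (A : vectType K) (m : 'Hom(A, 'End(A))) :
  balanced m (rmult m) \1%VF.
Proof. by move=> u v; rewrite !id_lfunE rmultE. Qed.

Lemma bimodule_hom_id (K : fieldType) (A : vectType K) (m : 'Hom(A, 'End(A))) :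
  bimodule_hom m m (rmult m) \1%VF.
Proof. by split=> x u; rewrite !id_lfunE ?rmultE. Qed.

(** With [c = 2 / lambda], the terms linear in [c] without an outer [T] cancel, and
    [2 c = c ^+ 2 * lambda] matches the weight term. So the left side is [c ^+ 2] times the
    Rota-Baxter defect of [T], minus [m x y]. *)
Lemma rota_baxter_shift (K : fieldType) (A : vectType K) (m : 'Hom(A, 'End(A)))
    (T : 'End(A)) (lambda : K) :
  2%:R != 0 :> K -> lambda != 0 ->
  let a := (2%:R / lambda) *: T + \1%VF in
  rota_baxter m lambda T <->
  forall x y, m (a x) (a y) - a (m (a x) y + m x (a y)) = - m x y.
Proof.
move=> n2 nl a; pose c := 2%:R / lambda.
have c0 : c ^+ 2 != 0 by rewrite expf_neq0 // mulf_neq0 ?invr_eq0.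
have regE (k : K) (x : K^o) : k *: x = (k * x : K) by [].
have cl : 2%:R = c * lambda by rewrite divfK.
have aE x y : m (a x) (a y) - a (m (a x) y + m x (a y)) =
    c ^+ 2 *: (m (T x) (T y) - T (m (T x) y + m x (T y) + lambda *: m x y))
    - m x y.
  apply: eq_dual => f.
  rewrite /a -/c !(add_lfunE, scale_lfunE, id_lfunE, homD, homN, homZ) !regE.
  (* Writing [lambda] through [c] leaves [field] a single parameter. *)
  have -> : lambda = 2%:R / c by rewrite cl mulrAC divff ?mul1r // mulf_neq0 ?invr_eq0.
  field.
  by rewrite mulf_neq0 ?invr_eq0.
split=> h x y; first by rewrite aE h subrr scaler0 add0r.
have := h x y; rewrite aE => /(canRL (subrK _)); rewrite addNr => /eqP.
by rewrite scaler_eq0 (negPf c0) subr_eq0 => /eqP.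
Qed.

(** * The equivalences for both signs and for Rota-Baxter operators *)

Theorem corollary3p17 (K : fieldType) (charK : [pchar K] =i pred0)
    (A V : vectType K) (m : 'Hom(A, 'End(A))) (l r : 'Hom(A, 'End(V)))
    (hA : is_novikov m) (hV : is_bimodule m l r)
    (kappa : K) (alpha beta : 'Hom(V, A))
    (hbal : balanced l r beta) (hhom : bimodule_hom m l r beta) :
  let mV := dual_semidirect m l r in
  let mA := dual_semidirect m m (rmult m) in
  let Pminus := check alpha - flip (check alpha) in
  let Qplus := check beta + flip (check beta) in
  let idplus := check (\1%VF : 'End(A)) + flip (check (\1%VF : 'End(A))) in
  ((ext_O_operator m l r kappa beta alpha <->
      ext_nybe mV ((kappa + 1) / 4%:R) (Pminus + Qplus)) /\
   (ext_O_operator m l r kappa beta alpha <->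
      ext_nybe mV ((kappa + 1) / 4%:R) (Pminus - Qplus))) /\
  ((O_operator m l r alpha <-> skew_symmetric Pminus /\ nybe mV Pminus) /\
   (forall T : 'End(A),
      rota_baxter m 0 T <->
      skew_symmetric (check T - flip (check T)) /\
      nybe mA (check T - flip (check T)))) /\
  ((ext_O_operator m l r (-1) beta alpha <-> nybe mV (Pminus + Qplus)) /\
   (ext_O_operator m l r (-1) beta alpha <-> nybe mV (Pminus - Qplus))) /\
  (forall a : 'End(A),
    let eq_a := forall x y,
      m (a x) (a y) - a (m (a x) y + m x (a y)) = - m x y in
    (eq_a <-> nybe mA (check a - flip (check a) + idplus)) /\
    (eq_a <-> nybe mA (check a - flip (check a) - idplus))) /\
  (forall (T : 'End(A)) (lambda : K), lambda != 0 ->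
    rota_baxter m lambda T <->
    nybe mA ((2%:R / lambda) *: (check T - flip (check T))
             + 2%:R *: check (\1%VF : 'End(A))) /\
    nybe mA ((2%:R / lambda) *: (check T - flip (check T))
             - 2%:R *: flip (check (\1%VF : 'End(A))))).
Proof.
have n0 n : (n.+1)%:R != 0 :> K by rewrite (pcharf0P K).1.
have n2 := n0 1%N; have n4 := n0 3%N.
(* The minus sign is the plus case for [- beta]: it is again a balanced homomorphism, and the
   extension term is even in [beta]. *)
have hbN := balancedN hbal; have hhN := bimodule_homN hhom.
move=> mV mA Pminus Qplus idplus.
have QN : - Qplus = check (- beta) + flip (check (- beta)).
  by rewrite !checkN flipN -opprD.
have ext k : (ext_O_operator m l r k beta alpha <->
      ext_nybe mV ((k + 1) / 4%:R) (Pminus + Qplus)) /\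
   (ext_O_operator m l r k beta alpha <->
      ext_nybe mV ((k + 1) / 4%:R) (Pminus - Qplus)).
  have O := ext_O_operatorE k alpha hbal hhom.
  split; apply: (iff_trans O); apply: iff_sym.
    exact: ext_nybe_extended n4 hbal hhom.
  rewrite QN; apply: (iff_trans (ext_nybe_extended k alpha n4 hbN hhN)).
  by split=> h u v; move: (h u v); rewrite !opp_lfunE !homN opp_lfunE opprK.
have iia (a : 'End(A)) :
    let eq_a := forall x y,
      m (a x) (a y) - a (m (a x) y + m x (a y)) = - m x y in
    (eq_a <-> nybe mA (check a - flip (check a) + idplus)) /\
    (eq_a <-> nybe mA (check a - flip (check a) - idplus)).
  have idN : - idplus = check (- \1%VF : 'End(A)) + flip (check (- \1%VF : 'End(A))).
    by rewrite !checkN flipN -opprD.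
  have hi := @balanced_id _ _ m; have hh := @bimodule_hom_id _ _ m.
  move=> eq_a; rewrite idN; split; apply: iff_sym.
    apply: (iff_trans (nybe_extended a n4 hi hh)).
    by split=> h u v; move: (h u v); rewrite rmultE !id_lfunE.
  apply: (iff_trans (nybe_extended a n4 (balancedN hi) (bimodule_homN hh))).
  by split=> h u v; move: (h u v);
    rewrite rmultE !opp_lfunE !id_lfunE !homN opp_lfunE opprK.
split; first exact: ext.
split.
  split.
    have E := nybe_O_operator m l r alpha n4.
    split=> [/E h | [_ /E //]].
    by split; first exact: skew_symmetric_sub_flip.
  move=> T; have E := nybe_O_operator m m (rmult m) T n4.
  have TE : rota_baxter m 0 T <-> O_operator m m (rmult m) T.
    by split=> h u v; move: (h u v); rewrite scale0r addr0 rmultE.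
  split=> [/TE /E h | [_ /E /TE //]].
  by split; first exact: skew_symmetric_sub_flip.
split; first by have := ext (-1); rewrite addNr mul0r.
split; first exact: iia.
move=> T lambda nl; apply: (iff_trans (rota_baxter_shift m T n2 nl)).
set a := _ *: T + _.
have addE (W : lmodType K) (x y z : W) :
    x + 2%:R *: y = x + (y - z) + (y + z).
  by rewrite -addrA [y + z]addrC subrKA scaler_nat mulr2n.
have subE (W : lmodType K) (x y z : W) :
    x - 2%:R *: z = x + (y - z) - (y + z).
  by rewrite opprD -addrA addrACA subrr add0r scaler_nat mulr2n opprD.
(* The skew part of [check a] contributes the skew part of [check \1]. Adding [idplus] to it doubles
   [check \1]; subtracting [idplus] leaves minus twice its flip. *)
have aE : check a - flip (check a) = (2%:R / lambda) *: (check T - flip (check T))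
    + (check (\1%VF : 'End(A)) - flip (check (\1%VF : 'End(A)))).
  by rewrite checkP flipD flipZ opprD addrACA scalerBr.
have -> : (2%:R / lambda) *: (check T - flip (check T)) + 2%:R *: check (\1%VF : 'End(A))
    = check a - flip (check a) + idplus.
  by rewrite aE; exact: addE.
(* The flip is essential in this tensor. With [check \1] in its place, the shifted operator would be
   [(2 / lambda) T - \1], which corresponds to weight [- lambda]. *)
have -> : (2%:R / lambda) *: (check T - flip (check T)) - 2%:R *: flip (check (\1%VF : 'End(A)))
    = check a - flip (check a) - idplus.
  by rewrite aE; exact: subE.
have [i1 i2] := iia a.
by split=> [h | [/i1 h _]]; [split; [exact/i1 | exact/i2] | exact: h].
Qed.
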